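(* Let $n\ge1$ and $m\ge0$ be integers and $\epsilon\in\{0,1\}$. For $t\in[-1,1]$, $$u_{2n+\epsilon,\,2n-2m-1}(t)=u_{2n+1+\epsilon,\,2n-2m}(t)=-|t|\,t^{2m+\epsilon}+f^\epsilon_{m,n}(t),$$ where $$f^{\epsilon}_{m,n}(t)= t^{\epsilon}\,\frac{(\frac12+\epsilon)_{n}\,\bigl(n^2+(\frac32+\epsilon)n+m+1+\epsilon\bigr)\,(-m+\frac12)_{n}}{(m+1+\epsilon)_{n+1}\,(n+1)!}\;{}_4F_3\!\left({-n,\ -n^2-(\frac32+\epsilon)n-m-\epsilon,\ -m-\frac12,\ n+\frac32+\epsilon \atop \frac12+\epsilon,\ -n^2-(\frac32+\epsilon)n-m-1-\epsilon,\ -m+\frac12};\,t^2\right).$$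
   Context: $(a)_0=1$, $(a)_j=a(a+1)\cdots(a+j-1)$ for $j\ge1$; ${}_pF_q\left({a_1,\dots,a_p\atop b_1,\dots,b_q};t\right)=\sum_{i\ge0}\frac{(a_1)_i\cdots(a_p)_i}{(b_1)_i\cdots(b_q)_i\,i!}t^i$. For an integer $N\ge2$ let $P^N$ be the orthogonal projection of $L^2[-1,1]$ onto the space of polynomials of degree at most $N$ vanishing at $t=1$ and $t=-1$. On $[-1,1]$ let $\bar u_M(t)=1-|t|\,t^{M-1}$ for odd $M\ge1$ and $\bar u_M(t)=t-|t|\,t^{M-1}$ for even $M\ge2$ (and $\bar u_M=0$ outside $[-1,1]$). For $N\ge 2$, $M\ge1$ set $$u_{N,N-M}=(I-P^N)\bar u_M .$$ *)

(* Defs.v *)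
From mathcomp Require Import all_boot all_order all_algebra.
From mathcomp Require Import all_classical all_reals all_analysis.

Set Implicit Arguments.
Unset Strict Implicit.
Unset Printing Implicit Defensive.

Import Order.TTheory GRing.Theory Num.Theory.
Import numFieldNormedType.Exports.

Local Open Scope classical_set_scope.
Local Open Scope ring_scope.

Definition poch (R : realType) (a : R) (j : nat) : R :=
  \prod_(i < j) (a + i%:R).

(* The series may have vanishing denominators (x / 0 = 0 here) when a lower
   parameter is a nonpositive integer -k. In a terminating series, with an upper
   parameter -n and n <= k, this affects only terms whose numerator is already
   0. *)
Definition pFq (R : realType) (a b : seq R) (t : R) : R :=
  limn (series (fun i : nat =>
    (\prod_(x <- a) poch x i) / ((\prod_(y <- b) poch y i) * i`!%:R) * t ^+ i)).

(* `size p <= N.+1` says that p has degree at most N. *)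
Definition polyV (R : realType) (N : nat) : set {poly R} :=
  [set p : {poly R} | (size p <= N.+1)%N /\ p.[1] = 0 /\ p.[-1] = 0].

Definition L2dot (R : realType) (f g : R -> R) : R :=
  \int[@lebesgue_measure R]_(t in `[-1, 1]) (f t * g t).

Definition is_orthproj (R : realType) (N : nat) (f : R -> R) (q : {poly R}) :=
  polyV N q /\
  forall p : {poly R}, polyV N p ->
    L2dot (fun t => f t - q.[t]) (fun t => p.[t]) = 0.

(* For f square-integrable on [-1, 1] there is exactly one such polynomial; the
   default value 0 is only relevant for other functions f. The image of P^N is
   represented by its polynomial, hence by a continuous function. *)
Definition projP (R : realType) (N : nat) (f : R -> R) : {poly R} :=
  xget 0 [set q : {poly R} | is_orthproj N f q].

Definition ubar (R : realType) (M : nat) (t : R) : R :=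
  if -1 <= t <= 1 then
    (if odd M then 1 else t) - `|t| * t ^+ M.-1
  else 0.

(* The second index k of u_{N,k} is an integer, k = N - M with M >= 1, so that
   M = N - k = |N - k|. *)
Definition u_ (R : realType) (N : nat) (k : int) (t : R) : R :=
  let M := `|N%:Z - k|%N in
  ubar M t - (projP N (ubar (R := R) M)).[t].

Definition f_ (R : realType) (e m n : nat) (t : R) : R :=
  let e' : R := e%:R in
  let m' : R := m%:R in
  let n' : R := n%:R in
  t ^+ e *
  ((poch (1/2 + e') n * (n' ^+ 2 + (3/2 + e') * n' + m' + 1 + e')
      * poch (- m' + 1/2) n)
   / (poch (m' + 1 + e') n.+1 * (n.+1)`!%:R)) *
  pFq [:: - n'; - n' ^+ 2 - (3/2 + e') * n' - m' - e';
          - m' - 1/2; n' + 3/2 + e']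
      [:: 1/2 + e'; - n' ^+ 2 - (3/2 + e') * n' - m' - 1 - e'; - m' + 1/2]
      (t ^+ 2).

(* Main.v *)
From HB Require Import structures.
Require Import Defs.
From mathcomp Require Import all_boot all_order all_algebra.
From mathcomp Require Import all_classical all_reals all_analysis.
From mathcomp Require Import ring lra zify.
From mathcomp Require polyrcf.

Set Implicit Arguments.
Unset Strict Implicit.
Unset Printing Implicit Defensive.

Import Order.TTheory GRing.Theory Num.Theory.
Import numFieldNormedType.Exports.

Local Open Scope classical_set_scope.
Local Open Scope ring_scope.

(* By parity, [q = t^e - f] is the projection of [t^e - |t| t^(2m+e)] as soon as
   [f(1) = 1] and [int_0^1 (f - t^(2m+e+1)) (t^2 - 1) t^(2j+e) dt = 0] for all
   [j < n]. With [b = e + 1/2], [s = m + 1/2], [z = b + j] and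
   [f = t^e sum_k c_k t^(2k)], these conditions are [sum_k c_k = 1] and
   [sum_k c_k (1/(z+k) - 1/(z+k+1)) = 1/(z+s) - 1/(z+s+1)].
   Let [J_k = (-n)_k (b+n+1)_k / ((b)_k k!)], the coefficients of a Jacobi
   polynomial for the weight [x^(b-1) (1-x)]. Up to a constant,
   [c_k = (1 + (n+1)(n+b) / (s-k)) J_k], and everything follows from the partial
   fraction expansion
   [phi prod_(j<=n) (y-b-j)/(y+j) = phi - sum_k J_k/(y+k)]
   read at [y = b+j] (left side 0), at [y = -s], and at infinity. *)

(** * Pochhammer symbols and the residues of the expansion *)

Lemma pochS (R : realType) (a : R) j : poch a j.+1 = poch a j * (a + j%:R).
Proof. by rewrite /poch big_ord_recr. Qed.

Lemma poch0 (R : realType) (a : R) : poch a 0 = 1.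
Proof. by rewrite /poch big_ord0. Qed.

Lemma pochD (R : realType) (a : R) i j :
  poch a (i + j) = poch a i * poch (a + i%:R) j.
Proof.
elim: j => [|j IH]; first by rewrite addn0 poch0 mulr1.
by rewrite addnS !pochS IH natrD; ring.
Qed.

Lemma poch_gt0 (R : realType) (a : R) j : 0 < a -> 0 < poch a j.
Proof. by move=> a0; apply: prodr_gt0 => i _; rewrite ltr_wpDr. Qed.

Lemma poch_oppn (R : realType) n i : (i <= n)%N ->
  poch (- n%:R : R) i * (n - i)`!%:R = (-1) ^+ i * n`!%:R.
Proof.
elim: i => [|i IH] le_in; first by rewrite poch0 subn0.
have -> : (-1) ^+ i.+1 * n`!%:R = - ((-1) ^+ i * n`!%:R) :> R by rewrite exprS; ring.
rewrite -IH ?(ltnW le_in)// pochS -(subnSK le_in) factS natrM (subnSK le_in).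
by rewrite natrB ?(ltnW le_in)//; ring.
Qed.

(** The factors with [j < i] give [(-1)^i i!], those with [j > i] give [(n-i)!]. The product is the
    derivative of [prod_j (y+j)] at its root [y = -i], the denominator of a residue there. *)
Lemma prod_subr_ord (R : realType) n (i : 'I_n.+1) :
  \prod_(j < n.+1 | j != i) (j%:R - i%:R : R) = (-1) ^+ i * i`!%:R * (n - i)`!%:R.
Proof.
rewrite (eq_bigl (fun j : 'I_n.+1 => (j : nat) != i)) //.
rewrite -(big_mkord (fun j => j != i :> nat) (fun j => j%:R - i%:R : R)).
rewrite (big_cat_nat _ (n := i)) //=; last exact: ltnW.
rewrite [X in _ * X]big_ltn_cond// eqxx /=; congr (_ * _).
  rewrite big_nat_cond (eq_bigl (fun j => (0 <= j < i)%N)); last first.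
    by move=> j; apply: andb_idr => ?; rewrite neq_ltn; lia.
  rewrite -big_nat big_mkord.
  rewrite (reindex_inj rev_ord_inj) /= (eq_bigr (fun j : 'I_i => - 1 * (j.+1)%:R)).
    rewrite big_split /= prodr_const card_ord fact_prod natr_prod.
    by rewrite big_add1 big_mkord.
  by move=> j _; rewrite natrB//; ring.
rewrite big_nat_cond (eq_bigl (fun j => (i.+1 <= j < n.+1)%N)); last first.
  by move=> j; apply: andb_idr => ?; rewrite neq_ltn; lia.
rewrite -big_nat -{1}(add0n i.+1) big_addn subSS fact_prod natr_prod big_add1.
by apply: eq_big_nat => j _; rewrite -addSnnS natrD addrK.
Qed.

Definition jac (R : realType) (b : R) n k : R :=
  poch (- n%:R) k * poch (b + n.+1%:R) k / (poch b k * k`!%:R).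

(* The residue of the expansion at [y = 0] determines [phi], as [J_0 = 1]. *)
Definition jacmass (R : realType) (b : R) n : R :=
  (-1) ^+ n * n`!%:R / poch b n.+1.

(** Both sides of the partial fraction expansion have the same residue at [y = -i]; here the
    denominator [prod_(j != i) (j-i)] is cleared. *)
Lemma jac_residue (R : realType) (b : R) n (i : 'I_n.+1) : 0 < b ->
  jacmass b n * \prod_(j < n.+1) (- i%:R - (b + j%:R))
  = - (jac b n i * \prod_(j < n.+1 | j != i) (j%:R - i%:R)).
Proof.
move=> b0; rewrite prod_subr_ord /jac /jacmass.
have -> : \prod_(j < n.+1) (- i%:R - (b + j%:R)) =
    (-1) ^+ n.+1 * (poch (b + i%:R) n.+1) :> R.
  rewrite -[n.+1 in X in X * _]card_ord -prodr_const /poch -big_split /=.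
  by apply: eq_bigr => j _; ring.
(* Split [(b)_(n+1+i)] after [i] factors and after [n+1] factors. *)
have bi : poch (b + i%:R) n.+1 = poch b n.+1 * poch (b + n.+1%:R) i / poch b i.
  by rewrite -pochD addnC pochD mulrAC divff ?mul1r// gt_eqF ?poch_gt0.
have /(canRL (mulfK _)) -> := poch_oppn R (ltn_ord i : (i <= n)%N); last first.
  by rewrite pnatr_eq0 -lt0n fact_gt0.
have h1 : (-1) ^+ n * (-1) ^+ n = 1 :> R by rewrite -expr2 sqrr_sign.
have h2 : (-1) ^+ i * (-1) ^+ i = 1 :> R by rewrite -expr2 sqrr_sign.
rewrite bi exprS.
have p1 : poch b n.+1 != 0 by rewrite gt_eqF ?poch_gt0.
have p2 : poch b i != 0 by rewrite gt_eqF ?poch_gt0.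
have f1 : i`!%:R != 0 :> R by rewrite pnatr_eq0 -lt0n fact_gt0.
have f2 : (n - i)`!%:R != 0 :> R by rewrite pnatr_eq0 -lt0n fact_gt0.
transitivity (- (n`!%:R * poch (b + n.+1%:R) i / poch b i * ((-1) ^+ n * (-1) ^+ n)) : R).
  by field; rewrite p1 p2.
rewrite h1 -[X in _ * X]h2; field; rewrite ?p1 ?p2 ?f1 ?f2//.
Qed.

(** * The partial fraction expansion and its special values *)

(** The size bound is on [p - q], so that leading terms may cancel: [jac_poly] compares polynomials
    of degree [n+1] at only [n+1] points. *)
Lemma eq_poly_points (R : idomainType) n (p q : {poly R}) (x : 'I_n -> R) :
  injective x -> (size (p - q)%R <= n)%N -> (forall i, p.[x i] = q.[x i]) -> p = q.
Proof.
move=> xI sz pq; apply/eqP; rewrite -subr_eq0; apply/eqP.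
apply: (@roots_geq_poly_eq0 _ _ (codom x)).
- by apply/allP => _ /codomP[i ->]; rewrite /root hornerD hornerN pq subrr.
- by rewrite map_inj_uniq ?enum_uniq.
- by rewrite size_codom card_ord.
Qed.

Lemma size_subr_monic (R : nzRingType) n (p q : {poly R}) :
  p \is monic -> q \is monic -> size p = n.+1 -> size q = n.+1 ->
  (size (p - q)%R <= n)%N.
Proof.
move=> /monicP pm /monicP qm sp sq; apply/leq_sizeP => j.
rewrite leq_eqVlt coefB => /predU1P[<-|nj].
  by move: pm qm; rewrite !lead_coefE sp sq /= => -> ->; rewrite subrr.
by rewrite !nth_default ?sp ?sq// subrr.
Qed.

Lemma size_prod_ord_XsubC (R : nzRingType) n (x : 'I_n -> R) :
  size (\prod_(j < n) ('X - (x j)%:P)) = n.+1.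
Proof.
by rewrite size_prod_XsubC /index_enum -enumT -cardE card_ord.
Qed.

Lemma size_prod_ordD1_XsubC (R : comNzRingType) n (x : 'I_n.+1 -> R) k :
  size (\prod_(j < n.+1 | j != k) ('X - (x j)%:P)) = n.+1.
Proof.
rewrite -big_filter size_prod_XsubC; congr _.+1.
transitivity #|predC1 k|; last by rewrite cardC1 card_ord.
by rewrite cardE /enum_mem; congr size; apply: eq_filter.
Qed.

Lemma coefPn_prod_ord_XsubC (R : comNzRingType) n (x : 'I_n.+1 -> R) :
  (\prod_(j < n.+1) ('X - (x j)%:P))`_n = - \sum_(j < n.+1) x j.
Proof.
have := @coefPn_prod_XsubC R (codom x).
by rewrite size_codom card_ord big_image /= big_image => ->.
Qed.

(** This is the expansion with its denominators cleared. The terms of degree [n+1] agree, so the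
    points [y = -i] suffice; there only the [i]-th summand survives and [jac_residue] applies. *)
Lemma jac_poly (R : realType) (b : R) n : 0 < b ->
  jacmass b n *: \prod_(j < n.+1) ('X - (b + j%:R)%:P) =
  jacmass b n *: \prod_(j < n.+1) ('X - (- j%:R)%:P)
  - \sum_(k < n.+1) jac b n k *: \prod_(j < n.+1 | j != k) ('X - (- j%:R)%:P).
Proof.
move=> b0; apply: (@eq_poly_points _ n.+1 _ _ (fun i : 'I_n.+1 => - i%:R)).
- by move=> i j /oppr_inj/eqP; rewrite eqr_nat => /eqP/val_inj.
- rewrite opprB addrCA -scalerBr.
  rewrite (leq_trans (size_polyD _ _))// geq_max; apply/andP; split; last first.
    rewrite (leq_trans (size_scale_leq _ _))//.
    by apply: size_subr_monic; rewrite ?monic_prod_XsubC ?size_prod_ord_XsubC.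
  apply: (leq_trans (size_sum _ _ _)); apply/bigmax_leqP => k _.
  by rewrite (leq_trans (size_scale_leq _ _))// size_prod_ordD1_XsubC.
move=> i; rewrite hornerD hornerN !hornerZ !horner_prod horner_sum.
rewrite (eq_bigr (fun j : 'I_n.+1 => - i%:R - (b + j%:R))); last first.
  by move=> j _; rewrite hornerXsubC.
rewrite jac_residue// [X in _ * X - _](bigD1 i)//= hornerXsubC subrr mul0r mulr0 sub0r.
congr (- _); rewrite [RHS](bigD1 i)//= [X in _ = _ + X]big1 ?addr0; last first.
  move=> k ki; rewrite hornerZ horner_prod (bigD1 i) 1?eq_sym//=.
  by rewrite hornerXsubC subrr mul0r mulr0.
rewrite hornerZ horner_prod; congr (_ * _); apply: eq_bigr => j _.
by rewrite hornerXsubC opprK addrC.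
Qed.

(** The behaviour at infinity: the coefficients of [y^n] in [jac_poly] give
    [sum_k J_k = phi (sum_j j + sum_j (b+j))]. *)
Lemma sum_jac (R : realType) (b : R) n : 0 < b ->
  \sum_(k < n.+1) jac b n k = jacmass b n * (n.+1%:R * (b + n%:R)).
Proof.
move=> /(jac_poly n) /(congr1 (fun p : {poly R} => p`_n)).
rewrite coefB !coefZ !coefPn_prod_ord_XsubC coef_sum => h.
have e : \sum_(k < n.+1) jac b n k = \sum_(k < n.+1)
    (jac b n k *: \prod_(j < n.+1 | j != k) ('X - (- j%:R)%:P))`_n.
  apply: eq_bigr => k _; rewrite coefZ.
  have /monicP := monic_prod_XsubC (index_enum 'I_n.+1) (predC1 k) (fun j => - j%:R : R).
  by rewrite lead_coefE size_prod_ordD1_XsubC/= => ->; rewrite mulr1.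
rewrite e -[LHS](subKr (jacmass b n * - \sum_(j < n.+1) - j%:R)) -h.
rewrite -mulrBr; congr (_ * _); rewrite sumrN opprK opprK big_split /=.
have gauss : \sum_(i < n.+1) (i%:R : R) = n.+1%:R * n%:R / 2.
  rewrite -natr_sum -(big_mkord predT id) bin2_sum bin2 /= -natrM.
  by rewrite -[in RHS](odd_double_half (n.+1 * n)) oddM /= andNb add0n -muln2 natrM mulfK.
by rewrite sumr_const card_ord gauss -mulr_natr; field.
Qed.

Lemma jac_frac (R : realType) (b y : R) n : 0 < b ->
  (forall j : 'I_n.+1, y + j%:R != 0) ->
  \sum_(k < n.+1) jac b n k / (y + k%:R) =
  jacmass b n * (1 - \prod_(j < n.+1) ((y - (b + j%:R)) / (y + j%:R))).
Proof.
move=> b0 y0; have := congr1 (fun p : {poly R} => p.[y]) (jac_poly n b0).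
rewrite hornerD hornerN !hornerZ !horner_prod horner_sum.
rewrite (eq_bigr (fun j : 'I_n.+1 => y - (b + j%:R))) => [|j _]; last first.
  by rewrite hornerXsubC.
rewrite [X in _ = _ * X - _](eq_bigr (fun j : 'I_n.+1 => y + j%:R)) => [h|j _]; last first.
  by rewrite hornerXsubC opprK.
have P0 : \prod_(j < n.+1) (y + j%:R) != 0 by apply/prodf_neq0 => j _.
rewrite prodf_div; apply: (mulIf P0).
rewrite -mulrA mulrBl divfK// mul1r mulrBr h opprB addrCA subrr addr0.
rewrite big_distrl/=; apply: eq_bigr => k _.
rewrite hornerZ horner_prod (bigD1 k)//= mulrA divfK//; congr (_ * _).
by apply: eq_bigr => j _; rewrite hornerXsubC opprK.
Qed.

Lemma sum_jac_node (R : realType) (b : R) n (j : nat) : 0 < b -> (j <= n)%N ->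
  \sum_(k < n.+1) jac b n k / (b + j%:R + k%:R) = jacmass b n.
Proof.
move=> b0 jn; rewrite jac_frac// => [|i]; last first.
  by rewrite gt_eqF// ltr_wpDr// ltr_wpDr.
by rewrite (bigD1 (Ordinal (jn : j < n.+1)%N))//= subrr !mul0r subr0 mulr1.
Qed.

(** * The coefficients of [f]: their sum and their moments *)

(** The product of the expansion at [y = -s], with the signs of numerators and denominators
    cancelled. *)
Definition momratio (R : realType) (b s : R) n : R :=
  \prod_(j < n.+1) ((s + b + j%:R) / (s - j%:R)).

Lemma sum_jac_pole (R : realType) (b s : R) n : 0 < b ->
  (forall j : 'I_n.+1, s - j%:R != 0) ->
  \sum_(k < n.+1) jac b n k / (s - k%:R) = jacmass b n * (momratio b s n - 1).
Proof.
move=> b0 s0; rewrite -[LHS]opprK -sumrN.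
rewrite (eq_bigr (fun k : 'I_n.+1 => jac b n k / (- s + k%:R))) => [|k _]; last first.
  by rewrite -[in RHS](opprK k%:R) -opprD invrN mulrN.
rewrite jac_frac// => [|j]; last by rewrite -[j%:R]opprK -opprD oppr_eq0.
rewrite -mulrN opprB; congr (_ * (_ - _)); apply: eq_bigr => j _.
rewrite -[in - s + j%:R](opprK j%:R) -[in - s - - _]opprD invrN mulrN -mulNr.
by congr (_ / _); ring.
Qed.

(** The second line sums over [k] to [phi + phi (momratio - 1)], by the values at infinity and at
    [y = -s]; the first factor normalizes this to 1. *)
Definition fcoef (R : realType) (b s : R) n k : R :=
  (jacmass b n * momratio b s n)^-1 *
  (((n.+1%:R * (b + n%:R))^-1 + (s - k%:R)^-1) * jac b n k).

Lemma jacmass_neq0 (R : realType) (b : R) n : 0 < b -> jacmass b n != 0.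
Proof.
move=> b0; rewrite !mulf_neq0 ?signr_eq0 ?pnatr_eq0 -?lt0n ?fact_gt0//.
by rewrite invr_neq0// gt_eqF ?poch_gt0.
Qed.

Lemma momratio_neq0 (R : realType) (b s : R) n : 0 < b -> 0 < s ->
  (forall j : 'I_n.+1, s - j%:R != 0) -> momratio b s n != 0.
Proof.
move=> b0 s0 sj; apply/prodf_neq0 => j _.
by rewrite mulf_neq0 ?invr_neq0// gt_eqF// ltr_wpDr// addr_gt0.
Qed.

Lemma sum_fcoef (R : realType) (b s : R) n : 0 < b -> 0 < s ->
  (forall j : 'I_n.+1, s - j%:R != 0) -> \sum_(k < n.+1) fcoef b s n k = 1.
Proof.
move=> b0 s0 sj; rewrite -mulr_sumr.
have phi0 := jacmass_neq0 n b0; have mom0 := momratio_neq0 b0 s0 sj.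
under eq_bigr do rewrite mulrDl [X in _ + X]mulrC.
rewrite big_split /= -mulr_sumr sum_jac// sum_jac_pole//.
have n1 : n.+1%:R != 0 :> R by rewrite pnatr_eq0.
have bn : b + n%:R != 0 by rewrite gt_eqF// ltr_wpDr.
move: n1 bn phi0 mom0; move: n.+1%:R (b + n%:R) (jacmass b n) (momratio b s n).
by move=> x y u v x0 y0 u0 v0; field; rewrite x0 y0 u0 v0.
Qed.

(** Since [j < n], both [z = b+j] and [z+1] are zeros of the product in the expansion, so
    [sum_k J_k/(z+k)] and [sum_k J_k/(z+1+k)] both equal [phi] and cancel. What remains is
    [phi momratio / ((z+s)(z+s+1))], and the normalization removes [phi momratio]. *)
Lemma fcoef_moment (R : realType) (b s : R) n (j : nat) : 0 < b -> 0 < s ->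
  (forall j : 'I_n.+1, s - j%:R != 0) -> (j < n)%N ->
  let z := b + j%:R in
  \sum_(k < n.+1) fcoef b s n k * ((z + k%:R)^-1 - (z + k%:R + 1)^-1)
  = (z + s)^-1 - (z + s + 1)^-1.
Proof.
move=> b0 s0 sj jn z.
have phi0 := jacmass_neq0 n b0; have mom0 := momratio_neq0 b0 s0 sj.
have z0 : 0 < z by rewrite ltr_wpDr.
have h1 := sum_jac_node b0 (ltnW jn); have h2 := sum_jac_node b0 jn.
have h3 := sum_jac_pole b0 sj.
set L := (n.+1%:R * (b + n%:R))^-1.
have zs0 : z + s != 0 by rewrite gt_eqF// addr_gt0.
have zs1 : z + s + 1 != 0 by rewrite gt_eqF// ltr_wpDr// addr_gt0.
(* Partial fractions of [1 / ((s-k) (z+k) (z+k+1))] with respect to [k]. *)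
pose T (k : nat) := (L + (z + s)^-1) *
    (jac b n k / (b + j%:R + k%:R) - jac b n k / (b + j.+1%:R + k%:R))
  + ((z + s) * (z + s + 1))^-1 *
    (jac b n k / (s - k%:R) + jac b n k / (b + j.+1%:R + k%:R)).
transitivity ((jacmass b n * momratio b s n)^-1 * \sum_(k < n.+1) T k).
  rewrite mulr_sumr; apply: eq_bigr => k _.
  rewrite /fcoef -/L -mulrA; congr (_ * _); rewrite /T.
  have -> : b + j.+1%:R + k%:R = z + k%:R + 1 by rewrite -natr1 /z; ring.
  rewrite -/z; move: (jac b n k) (sj k) => J sk.
  have zk : z + k%:R != 0 by rewrite gt_eqF// ltr_wpDr.
  have zk1 : z + k%:R + 1 != 0 by rewrite gt_eqF// ltr_wpDr// ltr_wpDr.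
  by field; rewrite zs0 zs1 zk zk1 sk.
rewrite big_split /= -!mulr_sumr sumrB big_split/= h1 h2 h3.
by field; rewrite phi0 mom0 zs0 zs1.
Qed.

(** * The hypergeometric form of the coefficients *)

Lemma limn_series_finite (R : realType) n (u : R^nat) :
  (forall i, (n <= i)%N -> u i = 0) -> limn (series u) = \sum_(i < n) u i.
Proof.
move=> u0; apply: lim_near_cst; first exact: norm_hausdorff.
exists n => // k /= nk; rewrite seriesEnat /= (big_cat_nat _ (n := n))//= big_mkord.
by rewrite [X in _ + X]big_nat [X in _ + X]big1 ?addr0// => i /andP[ni _]; exact: u0.
Qed.

(** For parameters that differ by one, the quotient of the Pochhammer symbols is a linear function
    of [i] or its inverse. *)
Lemma poch_shift (R : realType) (a : R) i : a * poch (a + 1) i = poch a i * (a + i%:R).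
Proof. by rewrite -pochS -add1n pochD pochS poch0 mul1r addr0. Qed.

Lemma poch_oppn_eq0 (R : realType) n i : (n < i)%N -> poch (- n%:R : R) i = 0.
Proof. by move=> ni; rewrite /poch (bigD1 (Ordinal ni))//= addNr mul0r. Qed.

Lemma half_sub_neq0 (R : realType) m j : (m%:R + 1/2 : R) - j%:R != 0.
Proof.
apply/eqP => /(congr1 ( *%R 2)); rewrite mulr0 => h.
have : (2 * m + 1)%:R = (2 * j)%:R :> R.
  by rewrite natrD !natrM; lra.
by move/eqP; rewrite eqr_nat => /eqP; lia.
Qed.

(** As a function of [i], [1/L + 1/(s-i)] with [L = (n+1)(b+n)] has its zero at [K = L+s] and its
    pole at [s]. This accounts for the parameter pairs [-K+1] over [-K] and [-s] over [-s+1]; the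
    other parameters are those of [jac]. *)
Lemma f_fcoef (R : realType) e m n (t : R) :
  f_ e m n t = t ^+ e *
    (\poly_(k < n.+1) fcoef (1/2 + e%:R) (m%:R + 1/2 : R) n k).[t ^+ 2].
Proof.
set b : R := 1/2 + e%:R; set s : R := m%:R + 1/2.
have b0 : 0 < b by rewrite ltr_pwDl.
have s0 : 0 < s by rewrite ltr_wpDl.
have sj j : s - j%:R != 0 by exact: half_sub_neq0.
rewrite /f_ -mulrA; congr (_ * _); rewrite /pFq (@limn_series_finite _ n.+1); last first.
  by move=> i ni; rewrite !big_cons poch_oppn_eq0// !mul0r.
rewrite horner_poly mulr_sumr; apply: eq_bigr => i _.
rewrite mulrA; congr (_ * _); rewrite !big_cons !big_nil !mulr1.
have le_in : (i <= n)%N by rewrite -ltnS.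
have n0 : 0 <= n%:R :> R by [].
pose L : R := n.+1%:R * (b + n%:R).
have L0 : 0 < L by rewrite mulr_gt0// ltr_wpDr.
pose K : R := L + s.
have LE : L = n%:R ^+ 2 + (3/2 + e%:R) * n%:R + b.
  by rewrite /L /b -natr1; field.
have K0 : 0 < K by rewrite addr_gt0.
(* [K] can be an integer, but [(-K)_i] is nonzero for [i <= n]; the later terms already vanish
   through [(-n)_i]. *)
have nK : n%:R < K.
  rewrite /K LE; have : 0 <= (n%:R : R) ^+ 2 by rewrite exprn_ge0.
  have : 0 <= (e%:R : R) * n%:R by rewrite mulr_ge0.
  by nra.
have -> : n%:R ^+ 2 + (3/2 + e%:R) * n%:R + m%:R + 1 + e%:R = K.
  by rewrite /K LE /b /s; field.
have -> : - n%:R ^+ 2 - (3/2 + e%:R) * n%:R - m%:R - 1 - e%:R = - K.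
  by rewrite /K LE /b /s; field.
have -> : - n%:R ^+ 2 - (3/2 + e%:R) * n%:R - m%:R - e%:R = - K + 1.
  by rewrite /K LE /b /s; field.
have -> : m%:R + 1 + e%:R = s + b by rewrite /b /s; field.
have -> : - m%:R - 1/2 = - s by rewrite /s; ring.
have -> : - m%:R + 1/2 = - s + 1 by rewrite /s; field.
have -> : n%:R + 3/2 + e%:R = b + n.+1%:R by rewrite /b -natr1; field.
have pK : poch (- K) i != 0.
  apply/prodf_neq0 => j _; rewrite lt_eqF// addrC subr_lt0 (le_lt_trans _ nK)//.
  by rewrite ler_nat ltnW// (leq_trans (ltn_ord j)).
have pb k : poch b k != 0 by rewrite gt_eqF ?poch_gt0.
have ps k : poch (- s + 1) k != 0.
  apply/prodf_neq0 => j _; rewrite -addrA nat1r -oppr_eq0 opprD opprK.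
  exact: sj.
have psb : poch (s + b) n.+1 != 0 by apply: lt0r_neq0; exact: poch_gt0 (addr_gt0 s0 b0).
have KN0 : K != 0 by rewrite gt_eqF.
have sN0 : s != 0 by rewrite gt_eqF.
have eK : poch (- K + 1) i = poch (- K) i * (K - i%:R) / K.
  by apply: (mulfI (x := - K)); rewrite ?oppr_eq0// poch_shift; field.
have es : poch (- s) i = s / (s - i%:R) * poch (- s + 1) i.
  apply: (mulIf (x := - s + i%:R)); first by rewrite -oppr_eq0 opprD opprK sj.
  by rewrite -poch_shift; field; exact: sj.
have mr : momratio b s n =
    poch (s + b) n.+1 / (s * ((-1) ^+ n * poch (- s + 1) n)).
  rewrite /momratio prodf_div; congr (_ / _).
  rewrite big_ord_recl subr0; congr (_ * _).
  rewrite -[X in _ = _ ^+ X * _](card_ord n) -prodr_const /poch -big_split/=; apply: eq_bigr => j _.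
  by rewrite /bump /= add1n -natr1; ring.
rewrite -/b eK es /fcoef mr /jac /jacmass -/L [poch b n.+1]pochS.
have -> : L^-1 + (s - i%:R)^-1 = (K - i%:R) / (L * (s - i%:R)).
  by rewrite /K; field; rewrite sj gt_eqF.
have sg0 : (-1) ^+ n != 0 :> R by rewrite signr_eq0.
rewrite factS natrM /L.
have bn : b + n%:R != 0 by rewrite gt_eqF// ltr_wpDr.
have n1 : n.+1%:R != 0 :> R by rewrite pnatr_eq0.
have f1 k : k`!%:R != 0 :> R by rewrite pnatr_eq0 -lt0n fact_gt0.
(* With Pochhammer symbols, factorials and signs replaced by variables, an identity of rational
   functions remains. *)
have aux (A B P1 P2 C D S1 I1 N1 B1 M1 sg Q T1 T2 k1 s1 : R) :
    A != 0 -> P1 != 0 -> P2 != 0 -> C != 0 -> D != 0 -> S1 != 0 -> I1 != 0 ->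
    N1 != 0 -> B1 != 0 -> M1 != 0 -> sg != 0 -> Q != 0 -> k1 != 0 -> s1 != 0 ->
    P2 * k1 * D / (S1 * (M1 * N1)) * (T1 * (Q * B / k1 * (s1 / A * C * T2)) /
      (P1 * (Q * C) * I1)) =
    (sg * N1 / (P2 * B1) * (S1 / (s1 * (sg * D))))^-1 *
      (B / (M1 * B1 * A) * (T1 * T2 / (P1 * I1))).
  move=> *; field.
  by do !(apply/andP; split).
exact: aux.
Qed.

(** * Integration of polynomials over [[0, 1]], done algebraically *)

(* For [i = 0] the coefficient is [p`_0 / 0 = 0]. *)
Definition antideriv (R : fieldType) (p : {poly R}) : {poly R} :=
  \poly_(i < (size p).+1) (p`_i.-1 / i%:R).

Lemma coef_antideriv (R : fieldType) (p : {poly R}) i :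
  (antideriv p)`_i = p`_i.-1 / i%:R.
Proof.
rewrite coef_poly; case: ltnP => // pi; rewrite nth_default ?mul0r//.
by case: i pi.
Qed.

Lemma deriv_antideriv (R : numFieldType) (p : {poly R}) : (antideriv p)^`() = p.
Proof.
by apply/polyP => i; rewrite coef_deriv coef_antideriv -[LHS]mulr_natr divfK ?pnatr_eq0.
Qed.

Lemma horner_antideriv0 (R : fieldType) (p : {poly R}) : (antideriv p).[0] = 0.
Proof. by rewrite horner_coef0 coef_antideriv invr0 mulr0. Qed.

(* [mom p] is [int_0^1 p]. *)
Definition mom (R : fieldType) (p : {poly R}) : R := (antideriv p).[1].

Fact mom_is_linear (R : fieldType) : scalar (@mom R).
Proof.
move=> a p q; rewrite /mom.
suff -> : antideriv (a *: p + q) = a *: antideriv p + antideriv q by rewrite hornerD hornerZ.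
apply/polyP => i; rewrite coefD coefZ !coef_antideriv coefD coefZ.
by rewrite mulrDl mulrA.
Qed.

HB.instance Definition _ (R : fieldType) :=
  GRing.isLinear.Build R {poly R} R *%R (@mom R) (@mom_is_linear R).

Lemma momXn (R : fieldType) k : mom ('X^k : {poly R}) = k.+1%:R^-1.
Proof.
rewrite /mom; have -> : antideriv 'X^k = k.+1%:R^-1 *: 'X^(k.+1) :> {poly R}.
  apply/polyP => -[|i]; rewrite coef_antideriv coefZ !coefXn/= ?invr0 ?mulr0// eqSS.
  by case: eqP => [->|]; rewrite ?mul1r ?mulr1// mul0r mulr0.
by rewrite hornerZ hornerXn expr1n mulr1.
Qed.

Lemma mom_ge0 (R : realType) (p : {poly R}) :
  (forall x, 0 <= x <= 1 -> 0 <= p.[x]) -> 0 <= mom p.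
Proof.
move=> p0; rewrite -(horner_antideriv0 p).
apply: (@polyrcf.ler_hornerW _ 0 1) => //; rewrite ?in_itv/= ?lexx ?ler01//.
by move=> x /andP[x0 x1]; rewrite deriv_antideriv p0// !ltW.
Qed.

(* The antiderivative is monotone with equal values at 0 and 1. *)
Lemma mom_eq0 (R : realType) (p : {poly R}) :
  (forall x, 0 <= x <= 1 -> 0 <= p.[x]) -> mom p = 0 -> p = 0.
Proof.
move=> p0 mp; suff A0 : antideriv p = 0 by rewrite -(deriv_antideriv p) A0 deriv0.
(* The points [1/(i+1)] are distinct and lie in [[0, 1]], so they supply as many roots as needed. *)
apply: (@eq_poly_points _ (size (antideriv p)) _ _ (fun i => i.+1%:R^-1)).
- by move=> i j /invr_inj/eqP; rewrite eqr_nat eqSS => /eqP/val_inj.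
- by rewrite subr0.
move=> i; rewrite horner0; apply/eqP; rewrite eq_le.
have x01 : i.+1%:R^-1 \in `[0, 1 :> R].
  by rewrite in_itv/= invr_ge0 ler0n invf_le1 ?ltr0n// ler1n.
have H : {in `[0, 1] &, {homo horner (antideriv p) : x y / x <= y}}.
  apply: polyrcf.ler_hornerW => x /andP[x0 x1].
  by rewrite deriv_antideriv p0// !ltW.
case/andP: (x01) => x0 x1; apply/andP; split.
  by rewrite -[leRHS]mp; apply: H; rewrite ?in_itv/= ?lexx ?ler01.
by rewrite -[leLHS](horner_antideriv0 p); apply: H; rewrite ?in_itv/= ?lexx ?ler01.
Qed.

(** * From Lebesgue integrals over [[-1, 1]] to [mom] *)

Lemma Rintegral_deriv_poly (R : realType) (P : {poly R}) (a b : R) : a < b ->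
  \int[@lebesgue_measure R]_(t in `[a, b]) P^`().[t] = P.[b] - P.[a].
Proof.
move=> ab; rewrite /Rintegral (@continuous_FTC2 _ _ (horner P))//.
- by apply: continuous_subspaceT; exact: continuous_horner.
- split; [by move=> x _; exact: derivable_horner| |].
    by apply: cvg_at_right_filter; exact: continuous_horner.
  by apply: cvg_at_left_filter; exact: continuous_horner.
- by move=> x _; rewrite derivE.
Qed.

(** Split the integral at 0 and reflect the left half. All later orthogonality arguments can then be
    carried out with the linear form [mom]. *)
Lemma L2dot_fold (R : realType) (f g : R -> R) (pl pr : {poly R}) :
  (forall t, 0 <= t <= 1 -> f t * g t = pr.[t]) ->
  (forall t, 0 <= t <= 1 -> f (- t) * g (- t) = pl.[t]) ->
  L2dot f g = mom (pr + pl).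
Proof.
move=> hr hl; rewrite /L2dot.
have p0 : pr.[0] = pl.[0].
  by rewrite -hr -?hl ?oppr0// lexx ler01.
(* The arguments are the positive and negative parts of [t], one of which is 0; as [pr] and [pl]
   agree at 0, [c] glues the two halves into a continuous, hence integrable, function. *)
pose c (t : R) := pr.[2^-1 * (`|t| + t)] + pl.[2^-1 * (`|t| - t)] - pr.[0].
have fg (t : R) : t \in `[-1, 1]%classic -> f t * g t = c t.
  rewrite inE /= in_itv/= /c => /andP[t1 t2]; have [t0|/ltW t0] := leP 0 t.
    rewrite hr ?t0// ger0_norm// subrr mulr0 -p0 addrK; congr _.[_]; by field.
  have [s tE] : exists s, t = - s by exists (- t); rewrite opprK.
  have s0 : 0 <= s by rewrite -oppr_le0 -tE.
  rewrite tE hl; last by rewrite s0 -lerN2 -tE.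
  rewrite normrN ger0_norm// subrr mulr0 addrAC subrr add0r opprK.
  by congr _.[_]; field.
rewrite (_ : Rintegral _ _ _ = \int[lebesgue_measure]_(t in `[-1, 1]) c t); last exact: eq_Rintegral.
have cc : continuous c.
  move=> t; apply: cvgB; last exact: cvg_cst.
  apply: cvgD.
    apply: (@continuous_comp _ _ _ (fun t : R => 2^-1 * (`|t| + t)) (horner pr)).
      by apply: cvgMr; apply: cvgD => //; exact: norm_continuous.
    exact: continuous_horner.
  apply: (@continuous_comp _ _ _ (fun t : R => 2^-1 * (`|t| - t)) (horner pl)).
    by apply: cvgMr; apply: cvgB => //; exact: norm_continuous.
  exact: continuous_horner.
have ci : (@lebesgue_measure R).-integrable `[-1, 1] (EFin \o c).
  apply: continuous_compact_integrable; first exact: segment_compact.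
  exact: continuous_subspaceT.
have i0 : (@lebesgue_measure R).-integrable `]0, 1] (EFin \o c).
  by apply: integrableS ci => //; apply: subset_itvr; rewrite bnd_simp; lra.
(* Removing the integral over [[-1, 0]] leaves []0, 1]], whose left end can be added at no cost. *)
rewrite -(subrK (\int[lebesgue_measure]_(t in `[-1, 0]) c t) (Rintegral _ _ _)).
rewrite Rintegral_itvB// ?bnd_simp ?lerN10// Rintegral_itv_obnd_cbnd//.
have right : \int[lebesgue_measure]_(t in `[0, 1]) c t = mom pr.
  rewrite -[RHS]subr0 -[in RHS](horner_antideriv0 pr) -Rintegral_deriv_poly//.
  apply: eq_Rintegral => t; rewrite inE /= in_itv /= => t01.
  rewrite deriv_antideriv -hr// fg// inE/= in_itv/=.
  by case/andP: t01 => t0 ->; rewrite (le_trans _ t0)// lerN10.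
have left : \int[lebesgue_measure]_(t in `[-1, 0]) c t = mom pl.
  have -> : mom pl = (- (antideriv pl \Po (- 'X))).[0] - (- (antideriv pl \Po (- 'X))).[-1].
    by rewrite !hornerN !horner_comp !hornerN !hornerX !opprK oppr0 horner_antideriv0 oppr0 add0r.
  rewrite -Rintegral_deriv_poly ?ltrN10//.
  apply: eq_Rintegral => t; rewrite inE /= in_itv /= => /andP[t1 t0].
  rewrite derivN deriv_comp deriv_antideriv derivN derivX mulrN1 opprK.
  rewrite horner_comp hornerN hornerX -hl ?opprK; last by rewrite oppr_ge0 t0 lerNl.
  by rewrite fg// inE/= in_itv/= t1 (le_trans t0).
by rewrite right left raddfD.
Qed.

(** * Uniqueness of the projection *)

(** The moment is the integral of [p^2] over [[-1, 1]], folded; both summands are nonnegative, so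
    the one over [[0, 1]] vanishes. *)
Lemma mom_sqr_eq0 (R : realType) (p : {poly R}) :
  mom (p * p + (p \Po - 'X) * (p \Po - 'X)) = 0 -> p = 0.
Proof.
have ge0 (q : {poly R}) x : 0 <= x <= 1 -> 0 <= (q * q).[x].
  by rewrite hornerM -expr2 sqr_ge0.
move/eqP; rewrite raddfD/= paddr_eq0; [|by apply: mom_ge0 => x; exact: ge0..].
by case/andP => /eqP/(mom_eq0 (ge0 _))/eqP; rewrite mulf_eq0 orbb => /eqP.
Qed.

Lemma polyV_sub (R : realType) N (p q : {poly R}) :
  polyV N p -> polyV N q -> polyV N (p - q).
Proof.
move=> [sp [p1 pN1]] [sq [q1 qN1]]; split.
  by rewrite (leq_trans (size_polyD _ _))// size_polyN geq_max sp.
by rewrite !hornerD !hornerN p1 q1 pN1 qN1 subrr.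
Qed.

(** The difference [d] of two candidates lies in [polyV N] and is orthogonal to both errors, hence
    to itself. *)
Lemma projP_uniq (R : realType) N (f : R -> R) (fl fr q : {poly R}) :
  (forall t, 0 <= t <= 1 -> f t = fr.[t]) ->
  (forall t, 0 <= t <= 1 -> f (- t) = fl.[t]) ->
  is_orthproj N f q -> projP N f = q.
Proof.
move=> hr hl; rewrite /projP => oq.
apply: xget_unique => // q' [q'V q'o]; have [qV qo] := oq.
apply/eqP; rewrite -subr_eq0; apply/eqP; apply: mom_sqr_eq0.
have dV := polyV_sub q'V qV.
have dotE (p d : {poly R}) : L2dot (fun t => f t - p.[t]) (fun t => d.[t]) =
    mom ((fr - p) * d + (fl - (p \Po - 'X)) * (d \Po - 'X)).
  apply: L2dot_fold => t t01; rewrite hornerM hornerD hornerN.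
    by rewrite hr.
  by rewrite !horner_comp hornerN hornerX hl.
have := q'o _ dV; have := qo _ dV; rewrite !dotE => h h'.
rewrite -[RHS](subrr 0) -{1}h -h' -raddfB/=; congr mom.
by rewrite comp_polyB; ring.
Qed.

Lemma polyV_factor (R : realType) N (p : {poly R}) : polyV N p ->
  exists2 r : {poly R}, p = r * ('X^2 - 1) & (size r <= N.-1)%N.
Proof.
move=> [sp [/eqP/factor_theorem[r1 p1] pN1]].
have /factor_theorem[r r1E] : root r1 (-1).
  move: pN1; rewrite p1 hornerM hornerXsubC => /eqP; rewrite mulf_eq0.
  by case/orP => // /eqP; lra.
have pE : p = r * ('X^2 - 1).
  by rewrite p1 r1E !rmorphN !rmorph1 /=; ring.
exists r => //; have [->|r0] := eqVneq r 0; first by rewrite size_poly0.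
move: sp; rewrite pE size_Mmonic ?monicXnsubC ?polyC1 //.
  by rewrite size_XnsubC//; lia.
Qed.

(** * Orthogonality of the error to the polynomials vanishing at 1 and -1 *)

Definition fpoly (R : realType) e m n : {poly R} :=
  \sum_(k < n.+1) fcoef (1/2 + e%:R) (m%:R + 1/2 : R) n k *: 'X^(2 * k + e).

Lemma horner_fpoly (R : realType) e m n (t : R) : (fpoly R e m n).[t] = f_ e m n t.
Proof.
rewrite f_fcoef horner_poly mulr_sumr horner_sum; apply: eq_bigr => k _.
by rewrite hornerZ hornerXn exprD exprM; ring.
Qed.

Lemma size_fpoly (R : realType) e m n : (size (fpoly R e m n) <= (2 * n + e).+1)%N.
Proof.
apply: (leq_trans (size_sum _ _ _)); apply/bigmax_leqP => k _.
rewrite (leq_trans (size_scale_leq _ _))// size_polyXn ltnS leq_add2r.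
by rewrite leq_mul2l /= -ltnS.
Qed.

Lemma horner1_fpoly (R : realType) e m n : (fpoly R e m n).[1] = 1.
Proof.
have b0 : 0 < 1/2 + e%:R :> R by rewrite ltr_pwDl.
have s0 : 0 < m%:R + 1/2 :> R by rewrite ltr_wpDl.
rewrite -[RHS](sum_fcoef (n := n) b0 s0); last by move=> j; exact: half_sub_neq0.
by rewrite horner_sum; apply: eq_bigr => k _; rewrite hornerZ hornerXn expr1n mulr1.
Qed.

Lemma hornerN_fpoly (R : realType) e m n (t : R) :
  (fpoly R e m n).[- t] = (-1) ^+ e * (fpoly R e m n).[t].
Proof.
rewrite !horner_sum mulr_sumr; apply: eq_bigr => k _.
by rewrite !hornerZ !hornerXn !(exprD _ (2 * k)) !exprM sqrrN (exprNn t e); ring.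
Qed.

(** The error [ubar - (t^e - f)] on [[0, 1]], where [|t| = t]; its parity is that of [e]. *)
Definition upoly (R : realType) e m n : {poly R} := fpoly R e m n - 'X^((2 * m + e).+1).

(** The exponents of [f] produce the denominators [2(z+k)] and [2(z+k+1)], and the exponent [2m+e+1]
    produces [2(z+s)] and [2(z+s+1)]. Up to the factor [-1/2] this is [fcoef_moment]. *)
Lemma mom_upoly (R : realType) e m n j : (j < n)%N ->
  mom (upoly R e m n * (('X^2 - 1) * 'X^(2 * j + e))) = 0.
Proof.
move=> jn; set b : R := 1/2 + e%:R; set s : R := m%:R + 1/2.
have b0 : 0 < b by rewrite ltr_pwDl.
have s0 : 0 < s by rewrite ltr_wpDl.
have := fcoef_moment b0 s0 (fun j => half_sub_neq0 _ _ _) jn; set z := b + j%:R => h.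
have z0 : 0 < z by rewrite ltr_wpDr.
have momM k : mom ('X^k * (('X^2 - 1) * 'X^(2 * j + e)) : {poly R}) =
    (k + (2 * j + e) + 3)%:R^-1 - (k + (2 * j + e) + 1)%:R^-1.
  rewrite mulrBl mul1r mulrBr -!exprD raddfB /= !momXn.
  by congr (_%:R^-1 - _%:R^-1); lia.
rewrite mulrBl raddfB /= momM mulr_suml raddf_sum /=.
have -> : \sum_(k < n.+1) mom (fcoef b s n k *: 'X^(2 * k + e) * (('X^2 - 1) * 'X^(2 * j + e)))
   = - 2^-1 * \sum_(k < n.+1) fcoef b s n k * ((z + k%:R)^-1 - (z + k%:R + 1)^-1).
  rewrite mulr_sumr; apply: eq_bigr => k _.
  rewrite -scalerAl linearZ /= momM mulrCA; congr (_ * _).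
  have -> : (2 * k + e + (2 * j + e) + 3)%:R = 2 * (z + k%:R + 1) :> R.
    by rewrite /z /b; field.
  have -> : (2 * k + e + (2 * j + e) + 1)%:R = 2 * (z + k%:R) :> R.
    by rewrite /z /b; field.
  by rewrite !invfM; ring.
rewrite h.
have -> : ((2 * m + e).+1 + (2 * j + e) + 3)%:R = 2 * (z + s + 1) :> R.
  by rewrite /z /b /s; field.
have -> : ((2 * m + e).+1 + (2 * j + e) + 1)%:R = 2 * (z + s) :> R.
  by rewrite /z /b /s; field.
by rewrite !invfM; ring.
Qed.

(** Folding keeps only the part of [p] with the parity of [e]. In [p = r (X^2-1)] these are the
    monomials [X^(2j+e)] of [r], and [size r <= N-1 <= 2n+e] forces [j < n]. *)
Lemma mom_upoly_polyV (R : realType) e m n N (p : {poly R}) :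
  (e <= 1)%N -> (N <= 2 * n + 1 + e)%N -> polyV N p ->
  mom (upoly R e m n * (p + (-1) ^+ e *: (p \Po - 'X))) = 0.
Proof.
move=> e1 Nn /polyV_factor[r -> sr].
have -> : r * ('X^2 - 1) + (-1) ^+ e *: (r * ('X^2 - 1) \Po - 'X) =
    \sum_(i < size r) (r`_i * (1 + (-1) ^+ (i + e))) *: (('X^2 - 1) * 'X^i).
  rewrite comp_polyM comp_polyB rmorphXn/= comp_polyX sqrrN comp_polyC.
  rewrite -[in LHS](coefK r) poly_def raddf_sum/= !mulr_suml scaler_sumr -big_split/=.
  apply: eq_bigr => i _; rewrite linearZ/= rmorphXn/= comp_polyX (exprNn 'X i).
  rewrite -!mul_polyC exprD !(polyCM, polyCD) !polyC_exp polyCN polyC1.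
  by move: ((-1) ^+ i) ((-1) ^+ e) => u v; ring.
rewrite mulr_sumr raddf_sum /= big1 // => i _.
rewrite -scalerAr linearZ /=.
have [io|io] := boolP (odd (i + e)).
  by rewrite -signr_odd io expr1 subrr mulr0 mul0r.
have [j ij] : exists j, i = (2 * j + e)%N :> nat.
  have := odd_double_half (i + e); rewrite (negbTE io) add0n -muln2 => h.
  by exists ((i + e)./2 - e)%N; lia.
have jr : (2 * j + e < size r)%N by rewrite -ij.
by rewrite ij mom_upoly ?mulr0//; move: jr sr; clear -Nn; lia.
Qed.

(** * The projection of [ubar] and the formula for [u_] *)

Lemma ubarE (R : realType) e m (t : R) : (e <= 1)%N -> -1 <= t <= 1 ->
  ubar (2 * m + 1 + e) t = t ^+ e - `|t| * t ^+ (2 * m + e).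
Proof.
move=> e1 t1; rewrite /ubar t1 (_ : (2 * m + 1 + e).-1 = 2 * m + e)%N; last by lia.
congr (_ - _); case: e e1 => [|[|]]//= _.
  by rewrite addn0 addn1 /= mul2n odd_double.
by rewrite !addn1 /= mul2n odd_double.
Qed.

(** The lower bound on [N] leaves room for the degree of [f], the upper bound gives orthogonality.
    Two consecutive values of [N] thus share one projection. *)
Lemma projP_ubar (R : realType) e m n N : (1 <= n)%N -> (e <= 1)%N ->
  (2 * n + e <= N <= 2 * n + 1 + e)%N ->
  projP N (ubar (R := R) (2 * m + 1 + e)) = 'X^e - fpoly R e m n.
Proof.
move=> n1 e1 /andP[N1 N2].
have hr (t : R) : 0 <= t <= 1 ->
    ubar (2 * m + 1 + e) t = ('X^e - 'X^((2 * m + e).+1)).[t].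
  move=> /andP[t0 t1]; rewrite ubarE//; last by rewrite t1 (le_trans _ t0)// lerN10.
  by rewrite hornerD hornerN !hornerXn ger0_norm// exprS.
have hl (t : R) : 0 <= t <= 1 ->
    ubar (2 * m + 1 + e) (- t) = ((-1) ^+ e *: ('X^e - 'X^((2 * m + e).+1))).[t].
  move=> /andP[t0 t1]; rewrite ubarE//; last first.
    by rewrite lerN2 t1 lerNl (le_trans _ t0)// lerN10.
  rewrite hornerZ hornerD hornerN !hornerXn normrN ger0_norm// exprS.
  rewrite (exprNn t e) (exprNn t (2 * m + e)) exprD exprM sqrrN !expr1n; ring.
apply: (projP_uniq hr hl); split.
  split.
    rewrite (leq_trans (size_polyD _ _))// size_polyN size_polyXn geq_max.
    by rewrite (leq_trans (size_fpoly _ _ _ _)) ?andbT ltnS//; lia.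
  split; first by rewrite hornerD hornerN hornerXn expr1n horner1_fpoly subrr.
  by rewrite hornerD hornerN hornerXn hornerN_fpoly horner1_fpoly mulr1 subrr.
move=> p pV; rewrite (L2dot_fold (pr := upoly R e m n * p)
  (pl := (-1) ^+ e *: (upoly R e m n * (p \Po - 'X)))).
- by rewrite -[RHS](mom_upoly_polyV m e1 N2 pV) scalerAr mulrDr.
- by move=> t t01; rewrite hr// hornerM !(hornerD, hornerN); ring.
move=> t t01; rewrite hl// !hornerZ hornerM horner_comp !(hornerD, hornerN).
by rewrite hornerN_fpoly !hornerXn hornerX (exprNn t e); ring.
Qed.

Theorem theorem7 (R : realType) (n m e : nat) (hn : (1 <= n)%N)
    (he : e = 0%N \/ e = 1%N) (t : R) (ht : -1 <= t <= 1) :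
  u_ (2 * n + e)%N (2 * n%:Z - 2 * m%:Z - 1) t
    = u_ (2 * n + 1 + e)%N (2 * n%:Z - 2 * m%:Z) t /\
  u_ (2 * n + 1 + e)%N (2 * n%:Z - 2 * m%:Z) t
    = - (`|t| * t ^+ (2 * m + e)) + f_ e m n t.
Proof.
have e1 : (e <= 1)%N by case: he => ->.
(* Both index pairs of the statement have [N - k = 2m+1+e]. *)
have uE N k : (2 * n + e <= N <= 2 * n + 1 + e)%N ->
    `|N%:Z - k|%N = (2 * m + 1 + e)%N ->
    u_ N k t = - (`|t| * t ^+ (2 * m + e)) + f_ e m n t.
  move=> hN hk; rewrite /u_ hk (projP_ubar _ _ hn e1 hN) ubarE//.
  by rewrite hornerD hornerN hornerXn horner_fpoly; ring.
by split; rewrite !uE//; lia.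
Qed.
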